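(* Let $n_x, n_u, n_w, N$ be positive integers, $\mu_0,\mu_d\in\mathbb{R}^{n_x}$, let $S_0,S_d\in\mathbb{R}^{n_x\times n_x}$ be symmetric positive definite, and let $A_k\in\mathbb{R}^{n_x\times n_x}$, $B_k\in\mathbb{R}^{n_x\times n_u}$, $G_k\in\mathbb{R}^{n_x\times n_w}$ be given for $k=0,\dots,N$. Let $\lambda>0$ be given. Let $\boldsymbol{\Gamma},\boldsymbol{H_u},\boldsymbol{F},\tilde S$ be the matrices built from these data as defined in the context. Let $\mathcal{T}$ be the linear space of block lower triangular matrices $\boldsymbol{\Theta}\in\mathbb{R}^{n_uN\times n_x(N+1)}$, as defined in the context. For $\boldsymbol{u}_{\mathrm{ff}}\in\mathbb{R}^{n_uN}$ and $\boldsymbol{\Theta}\in\mathcal{T}$ define $$J_1(\boldsymbol{u}_{\mathrm{ff}})=\|\boldsymbol{u}_{\mathrm{ff}}\|_2^2+\lambda\,\|\boldsymbol{F}(\boldsymbol{\Gamma}\mu_0+\boldsymbol{H_u}\boldsymbol{u}_{\mathrm{ff}})-\mu_d\|_2^2,$$ $$J_2(\boldsymbol{\Theta})=\operatorname{tr}(\boldsymbol{\Theta}\tilde S\boldsymbol{\Theta}^{\mathrm T}),$$ $$J_3(\boldsymbol{\Theta})=\lambda\operatorname{tr}\big(\boldsymbol{F}(\boldsymbol{I}+\boldsymbol{H_u}\boldsymbol{\Theta})\tilde S(\boldsymbol{I}+\boldsymbol{H_u}\boldsymbol{\Theta})^{\mathrm T}\boldsymbol{F}^{\mathrm T}\big)+\operatorname{tr}(S_d),$$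 $$J_4(\boldsymbol{\Theta})=2\lambda\operatorname{tr}\Big(\big(\sqrt{S_d}\,\boldsymbol{F}(\boldsymbol{I}+\boldsymbol{H_u}\boldsymbol{\Theta})\tilde S(\boldsymbol{I}+\boldsymbol{H_u}\boldsymbol{\Theta})^{\mathrm T}\boldsymbol{F}^{\mathrm T}\sqrt{S_d}\big)^{1/2}\Big).$$ Then the functions $J_1,J_2,J_3,J_4$ are convex. Consequently, the problem of minimizing $$J(\boldsymbol{u}_{\mathrm{ff}},\boldsymbol{\Theta})=J_1(\boldsymbol{u}_{\mathrm{ff}})+J_2(\boldsymbol{\Theta})+J_3(\boldsymbol{\Theta})-J_4(\boldsymbol{\Theta})$$ over all $(\boldsymbol{u}_{\mathrm{ff}},\boldsymbol{\Theta})\in\mathbb{R}^{n_uN}\times\mathcal{T}$ is a difference of convex functions program.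
   Context: For $k\ge n\ge 0$ put $\Phi(n,n)=\boldsymbol{I}$ and $\Phi(k,n)=A_{k-1}A_{k-2}\cdots A_n$ for $k>n$. $\boldsymbol{\Gamma}\in\mathbb{R}^{n_x(N+1)\times n_x}$ is the vertical stack of the blocks $\boldsymbol{I},\Phi(1,0),\Phi(2,0),\dots,\Phi(N,0)$. $\boldsymbol{H_u}\in\mathbb{R}^{n_x(N+1)\times n_uN}$ is the block matrix whose $(i,j)$ block ($i=0,\dots,N$, $j=0,\dots,N-1$, blocks of size $n_x\times n_u$) is $\Phi(i,j+1)B_j$ if $i>j$ and $\boldsymbol{0}$ otherwise. $\boldsymbol{H_w}\in\mathbb{R}^{n_x(N+1)\times n_wN}$ is defined in the same way with $G_j$ in place of $B_j$. $\boldsymbol{F}=[\boldsymbol{0}\ \cdots\ \boldsymbol{0}\ \boldsymbol{I}]\in\mathbb{R}^{n_x\times n_x(N+1)}$ selects the last block of size $n_x$. $\tilde S=\boldsymbol{\Gamma}S_0\boldsymbol{\Gamma}^{\mathrm T}+\boldsymbol{H_w}S_{\boldsymbol{w}}\boldsymbol{H_w}^{\mathrm T}$, where $S_{\boldsymbol{w}}=\mathbb{E}[\boldsymbol{w}\boldsymbol{w}^{\mathrm T}]$ is the second-moment matrix of the stacked noise $\boldsymbol{w}=[w_0^{\mathrm T},\dots,w_{N-1}^{\mathrm T}]^{\mathrm T}$. The noise is white Gaussian with $\mathbb{E}[w_k]=0$ and $\mathbb{E}[w_kw_m^{\mathrm T}]=\delta(k,m)\boldsymbol{I}$, where $\delta(k,m)=1$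 if $k=m$ and $0$ otherwise, so $S_{\boldsymbol{w}}=\boldsymbol{I}$. $\mathcal{T}$: a matrix $\boldsymbol{\Theta}\in\mathbb{R}^{n_uN\times n_x(N+1)}$, partitioned into blocks $\Theta_{ij}\in\mathbb{R}^{n_u\times n_x}$ with $i=0,\dots,N-1$, $j=0,\dots,N$, is block lower triangular if $\Theta_{ij}=\boldsymbol{0}$ whenever $j>i$ (in particular its last $n_x$ columns vanish). For a symmetric positive semidefinite matrix $M$, both $\sqrt{M}$ and $M^{1/2}$ denote its unique symmetric positive semidefinite square root. $\boldsymbol{I}$ and $\boldsymbol{0}$ denote identity and zero matrices of appropriate sizes, and $\operatorname{tr}$ is the trace. A difference of convex functions program (DCP) is an optimization problem whose objective (performance index) is equal to the difference of two convex functions of the decision variables. *)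

(* Defs.v *)
From HB Require Import structures.
From mathcomp Require Export all_boot all_order all_algebra.
From mathcomp Require Export all_classical all_reals all_analysis.

Set Implicit Arguments.
Unset Strict Implicit.
Unset Printing Implicit Defensive.

Import Order.TTheory GRing.Theory Num.Theory.
Import numFieldNormedType.Exports.

Local Open Scope classical_set_scope.
Local Open Scope ring_scope.

(* A block matrix with m x p blocks of uniform size a x b has type
   'M_(\sum_(i < m) a, \sum_(j < p) b), the type expected by \mxblock, \mxcol,
   \mxrow and submxblock; \sum_(i < m) a is provably m * a (sum_nat_const). *)

Definition psdmx (R : realType) (n : nat) (M : 'M[R]_n) : Prop :=
  M^T = M /\ forall x : 'cV[R]_n, 0 <= (x^T *m M *m x) 0 0.

Definition pdmx (R : realType) (n : nat) (M : 'M[R]_n) : Prop :=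
  M^T = M /\ forall x : 'cV[R]_n, x != 0 -> 0 < (x^T *m M *m x) 0 0.

(* The symmetric positive semidefinite square root: it exists and is unique
   when M is symmetric positive semidefinite; 0 is a junk value. *)
Definition sqrtmx (R : realType) (n : nat) (M : 'M[R]_n) : 'M[R]_n :=
  xget 0 [set Q | psdmx Q /\ Q *m Q = M].

(* The norm `|x| of the library on matrices is the sup norm. *)
Definition norm2 (R : realType) (n : nat) (x : 'cV[R]_n) : R :=
  Num.sqrt (\sum_i x i 0 ^+ 2).

(* A_{k-1} *m ... *m A_n, and 1%:M when k <= n. *)
Definition Phi (R : realType) (N nx : nat) (A : 'I_N.+1 -> 'M[R]_nx)
    (k n : nat) : 'M[R]_nx :=
  \big[mulmx/1%:M]_(j <- rev (index_iota n k)) A (inord j).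

Definition Gamma (R : realType) (N nx : nat) (A : 'I_N.+1 -> 'M[R]_nx) :
    'M[R]_(\sum_(i < N.+1) nx, nx) :=
  \mxcol_(i < N.+1) Phi A i 0.

(* H_u is Hmx A B and H_w is Hmx A G; the last matrix B N does not occur. *)
Definition Hmx (R : realType) (N nx m : nat) (A : 'I_N.+1 -> 'M[R]_nx)
    (B : 'I_N.+1 -> 'M[R]_(nx, m)) :
    'M[R]_(\sum_(i < N.+1) nx, \sum_(j < N) m) :=
  \mxblock_(i < N.+1, j < N)
    (if (j < i)%N then Phi A i j.+1 *m B (inord j) else 0).

Definition Fmx (R : realType) (N nx : nat) : 'M[R]_(nx, \sum_(j < N.+1) nx) :=
  \mxrow_(j < N.+1) (if j == ord_max then 1%:M else 0).

Definition block_lower_triangular (R : realType) (N nx nu : nat) :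
    set 'M[R]_(\sum_(i < N) nu, \sum_(j < N.+1) nx) :=
  [set Theta | forall (i : 'I_N) (j : 'I_N.+1), (i < j)%N ->
     submxblock Theta i j = 0].

(* Entrywise expectation. It is meaningful for integrable entries: fine sends
   infinite values to 0. *)
Definition expectation_mx (R : realType) (d : measure_display)
    (T : measurableType d) (P : probability T R) (m n : nat)
    (X : T -> 'M[R]_(m, n)) : 'M[R]_(m, n) :=
  \matrix_(i, j) fine ('E_P[fun t => X t i j])%E.

Definition stack (R : realType) (T : Type) (N n : nat)
    (w : 'I_N -> T -> 'cV[R]_n) (t : T) : 'cV[R]_(\sum_(k < N) n) :=
  \mxcol_(k < N) w k t.

(* Normal law of mean m and standard deviation s; s = 0 is the point mass. *)
Definition normal_law (R : realType) (m s : R) (D : set R) : \bar R :=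
  if s == 0 then \d_m D else normal_prob m s D.

(* Every linear combination of the entries is normal, possibly degenerate. *)
Definition gaussian_vector (R : realType) (d : measure_display)
    (T : measurableType d) (P : probability T R) (n : nat)
    (X : T -> 'cV[R]_n) : Prop :=
  (forall i, measurable_fun [set: T] (fun t => X t i 0)) /\
  (forall a : 'cV[R]_n, exists m s : R, forall D : set R, measurable D ->
     P [set t | D ((a^T *m X t) 0 0)] = normal_law m s D).

Definition white_gaussian_noise (R : realType) (d : measure_display)
    (T : measurableType d) (P : probability T R) (N n : nat)
    (w : 'I_N -> T -> 'cV[R]_n) : Prop :=
  [/\ gaussian_vector P (stack w),
      forall k, expectation_mx P (w k) = 0
    & forall k m, expectation_mx P (fun t => w k t *m (w m t)^T)
                  = ((k == m)%:R)%:M].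

Record minimization (R : numFieldType) (V : lmodType R) := Minimization {
  feasible : set V ;
  objective : V -> R }.

Definition is_dcp (R : numFieldType) (V : lmodType R)
    (p : minimization V) : Prop :=
  convex_set (feasible p) /\
  exists g h : V -> R,
    [/\ convex_function (feasible p) g, convex_function (feasible p) h
      & forall x, feasible p x -> objective p x = g x - h x].

(* Main.v *)
(* J1, J2, J3 are nonnegative quadratic forms of affine maps, up to constants.
   Factoring St = L *m L^T, the trace in J4 is the nuclear norm of X = M *m L
   with M = sqrtmx Sd *m F *m (1%:M + Hu *m Theta) affine in Theta. If P is a
   psd square root of X *m X^T, then \tr P is the maximum of \tr (X *m U^T)
   over the contractions U, whence the triangle inequality for X |-> \tr P.
   Existence of psd square roots follows from the real spectral theorem. *)
From mathcomp Require complex.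
From mathcomp Require Import ring lra.
Require Import Defs.

Set Implicit Arguments.
Unset Strict Implicit.
Unset Printing Implicit Defensive.

Import Order.TTheory GRing.Theory Num.Theory.
Import numFieldNormedType.Exports.
Local Open Scope classical_set_scope.
Local Open Scope ring_scope.
Local Open Scope convex_scope.

(** * Orthogonal diagonalization of real symmetric matrices *)

Lemma sqr_row_ge0 (R : realDomainType) n (x : 'rV[R]_n) : 0 <= (x *m x^T) 0 0.
Proof. by rewrite mxE sumr_ge0// => i _; rewrite mxE -expr2 sqr_ge0. Qed.

Lemma sqr_row_eq0 (R : realDomainType) n (x : 'rV[R]_n) :
  (x *m x^T) 0 0 = 0 -> x = 0.
Proof.
rewrite mxE => x0; apply/rowP => i; rewrite mxE; apply/eqP.
have h j : 0 <= x 0 j * x^T j 0 by rewrite mxE -expr2 sqr_ge0.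
have /(_ i isT)/eqP := psumr_eq0P (fun j _ => h j) x0.
by rewrite mxE -expr2 sqrf_eq0.
Qed.

Lemma dot_rowC (R : comPzRingType) n (x y : 'rV[R]_n) :
  (x *m y^T) 0 0 = (y *m x^T) 0 0.
Proof. by rewrite -[in LHS](trmxK x) -trmx_mul mxE. Qed.

Section RealEigenvector.
Import complex.

(** Over the algebraic closure there is an eigenvalue [a + ib] with eigenvector [x + iy]. Comparing
    [x *m A *m y^T] with [y *m A *m x^T], equal by symmetry, gives b(|x|^2 + |y|^2) = 0. Hence b =
    0, and whichever of [x], [y] is nonzero is a real eigenvector. *)
Lemma symmetric_real_eigenvector (R : rcfType) n (A : 'M[R]_n.+1) :
  A^T = A -> exists (a : R) (v : 'rV[R]_n.+1), v != 0 /\ v *m A = a *: v.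
Proof.
move=> Asym; pose Ac := map_mx (real_complex R) A.
have [[a b]] := @eigenvalue_closed _ _ Ac (ltn0Sn n).
case/eigenvalueP => v vE v0.
pose x := map_mx (@Re R) v; pose y := map_mx (@Im R) v.
have vxy : v = map_mx (real_complex R) x + 'i%C *: map_mx (real_complex R) y.
  by apply/rowP => i; rewrite !mxE -complexE.
have xyE j : (x *m A) 0 j = (a *: x - b *: y) 0 j /\
             (y *m A) 0 j = (a *: y + b *: x) 0 j.
  have /rowP/(_ j) := vE.
  rewrite [in LHS]vxy mulmxDl -scalemxAl -!map_mxM !mxE/=.
  by case: (v 0 j) => p q /=; simpc => -[-> ->]; rewrite [a * q + _]addrC.
have xA : x *m A = a *: x - b *: y by apply/rowP => j; have [] := xyE j.
have yA : y *m A = a *: y + b *: x by apply/rowP => j; have [] := xyE j.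
have b0 : b * ((x *m x^T) 0 0 + (y *m y^T) 0 0) = 0.
  have : (x *m A *m y^T) 0 0 = (y *m A *m x^T) 0 0.
    by rewrite -mulmxA -[A in LHS]Asym -trmx_mul dot_rowC.
  rewrite xA yA mulmxBl mulmxDl -!scalemxAl.
  have := dot_rowC x y; rewrite !mxE => ->; lra.
case: (eqVneq b 0) => [b00|bN0]; last first.
  move: b0 => /eqP; rewrite mulf_eq0 (negbTE bN0)/= paddr_eq0 ?sqr_row_ge0//.
  case/andP => /eqP/sqr_row_eq0 x0 /eqP/sqr_row_eq0 y0.
  by move: v0; rewrite vxy x0 y0 !map_mx0 scaler0 addr0 eqxx.
move: xA yA; rewrite b00 !scale0r subr0 addr0 => xA yA.
case: (eqVneq x 0) => [x0|]; last by exists a, x.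
exists a, y; split => //; apply: contra_neq v0 => y0.
by rewrite vxy x0 y0 !map_mx0 scaler0 addr0.
Qed.

End RealEigenvector.

(** The witness is the reflection in the hyperplane orthogonal to [u - v]. *)
Lemma householder (R : realFieldType) n (u v : 'rV[R]_n) :
  u *m u^T = 1%:M -> v *m v^T = 1%:M ->
  exists H : 'M[R]_n, H *m H^T = 1%:M /\ u *m H = v.
Proof.
move=> u1 v1; case: (eqVneq u v) => [<-|uv].
  by exists 1%:M; rewrite trmx1 !mulmx1.
(* Keeping [w] opaque prevents the rewrites below from expanding the difference. *)
have [w wE] : exists w, w = u - v by exists (u - v).
pose q := (w *m w^T) 0 0.
have q0 : q != 0.
  apply: contra_neq uv => /sqr_row_eq0 w0.
  by apply: subr0_eq; rewrite -wE w0.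
have wwE : w *m w^T = q%:M by rewrite [LHS]mx11_scalar.
(* For unit vectors, both sides equal 1 - <u, v>. *)
have uwE : u *m w^T = (q / 2)%:M.
  have -> : u *m w^T = ((u *m w^T) 0 0)%:M by rewrite [LHS]mx11_scalar.
  congr (_%:M); rewrite /q wE linearB/= !mulmxBr !mulmxBl u1 v1.
  have := dot_rowC u v; rewrite !mxE => ->; rewrite eqxx/=; lra.
exists (1%:M - (2 / q) *: (w^T *m w)); split; last first.
  rewrite mulmxBr mulmx1 -scalemxAr mulmxA uwE mul_scalar_mx scalerA.
  have -> : 2 / q * (q / 2) = 1 by field.
  by rewrite scale1r wE opprB addrC subrK.
have -> : (1%:M - (2 / q) *: (w^T *m w))^T = 1%:M - (2 / q) *: (w^T *m w).
  by rewrite linearB linearZ/= trmx1 trmx_mul trmxK.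
rewrite mulmxBl mul1mx mulmxBr mulmx1.
rewrite -scalemxAr -scalemxAl mulmxA -[w^T *m w *m w^T]mulmxA wwE.
rewrite mul_mx_scalar -scalemxAl !scalerA.
have -> : 2 / q * (2 / q) * q = 2 * (2 / q) by field.
rewrite -scalerBl -addrA -opprD -scalerDl.
have -> : 2 / q + (2 / q - 2 * (2 / q)) = 0 by ring.
by rewrite scale0r subr0.
Qed.

(* Householder's reflection moves a unit eigenvector to the first basis vector,
   which splits off a 1 x 1 block. *)
Lemma symmetric_spectral (R : rcfType) n (A : 'M[R]_n) : A^T = A ->
  exists (Q : 'M[R]_n) (a : 'rV[R]_n),
    Q *m Q^T = 1%:M /\ A = Q^T *m diag_mx a *m Q.
Proof.
elim: n A => [|n IHn] A Asym.
  by exists 1%:M, 0; split; [rewrite trmx1 mul1mx | apply/matrixP => -[]].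
have [a [v [v0 vA]]] := symmetric_real_eigenvector Asym.
pose s := Num.sqrt ((v *m v^T) 0 0).
have s0 : s != 0.
  rewrite sqrtr_eq0 -ltNge lt_def sqr_row_ge0 andbT.
  by apply: contra_neq v0 => /sqr_row_eq0.
pose v1 := s^-1 *: v.
have v1A : v1 *m A = a *: v1 by rewrite -scalemxAl vA !scalerA mulrC.
have v11 : v1 *m v1^T = 1%:M.
  rewrite linearZ/= -scalemxAl -scalemxAr scalerA [v *m _]mx11_scalar.
  rewrite -(sqr_sqrtr (sqr_row_ge0 v)) -/s scale_scalar_mx.
  by have -> : s^-1 * s^-1 * s ^+ 2 = 1 by field.
have e11 : (row_mx 1%:M 0 : 'rV[R]_(1 + n)) *m (row_mx 1%:M 0)^T = 1%:M.
  by rewrite tr_row_mx mul_row_col trmx1 mulmx1 mul0mx addr0.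
have [H [HH eH]] := householder e11 v11.
have HtH : H^T *m H = 1%:M by apply: mulmx1C.
pose M : 'M[R]_(1 + n) := H *m A *m H^T.
have Msym : M^T = M by rewrite !trmx_mul trmxK Asym mulmxA.
(* [H] sends the first basis vector to [v1], so that basis vector is a left eigenvector of [M];
   symmetry then makes [M] block diagonal. *)
have eM : row_mx 1%:M 0 *m M = row_mx a%:M 0.
  rewrite /M !mulmxA eH v1A -scalemxAl -eH -mulmxA HH mulmx1.
  by rewrite scale_row_mx scaler0 scale_scalar_mx mulr1.
have ME : M = block_mx a%:M 0 0 (drsubmx M).
  have [ul ur] : ulsubmx M = a%:M /\ ursubmx M = 0.
    apply: eq_row_mx; rewrite -eM -[in RHS](submxK M) mul_row_block.
    by rewrite !mul1mx !mul0mx !addr0.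
  rewrite -[LHS]submxK ul ur; congr block_mx.
  by rewrite -Msym -trmx_ursub ur trmx0.
have [|Q [b [QQ bE]]] := IHn (drsubmx M).
  by rewrite trmx_drsub Msym.
pose K : 'M[R]_(1 + n) := block_mx 1%:M 0 0 Q.
pose c : 'rV[R]_(1 + n) := row_mx a%:M b.
have KK : K *m K^T = 1%:M.
  rewrite /K tr_block_mx mulmx_block !trmx0 trmx1 !mulmx0 !mul0mx mulmx1.
  by rewrite !addr0 add0r QQ -scalar_mx_block.
have MK : M = K^T *m diag_mx c *m K.
  rewrite ME bE /K /c diag_mx_row tr_block_mx !mulmx_block.
  rewrite !trmx0 trmx1 !mulmx0 !mul0mx !mulmx1 !mul1mx !addr0 !add0r.
  by rewrite mul0mx; congr block_mx; apply/matrixP => i j; rewrite !ord1 !mxE.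
exists (K *m H), c; split.
  by rewrite trmx_mul mulmxA -[_ *m H *m _]mulmxA HH mulmx1.
have -> : (K *m H)^T *m diag_mx c *m (K *m H) = H^T *m M *m H.
  by rewrite MK trmx_mul !mulmxA.
by rewrite /M !mulmxA HtH mul1mx -mulmxA HtH mulmx1.
Qed.

(** * Semidefinite matrices, their square roots, and the trace of a root as a maximum over
    contractions *)

Section Semidefinite.
Variable R : realType.

Lemma psdmx_diag_ge0 n (M : 'M[R]_n) i : psdmx M -> 0 <= M i i.
Proof.
case=> _ /(_ (delta_mx i 0)); rewrite trmx_delta -rowE -colE.
by rewrite !mxE.
Qed.

Lemma psdmx_conj m n (B : 'M[R]_(m, n)) (M : 'M[R]_n) :
  psdmx M -> psdmx (B *m M *m B^T).
Proof.
case=> Msym M0; split=> [|x]; first by rewrite !trmx_mul trmxK Msym mulmxA.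
by have := M0 (B^T *m x); rewrite trmx_mul trmxK !mulmxA.
Qed.

Lemma psdmx_diag n (a : 'rV[R]_n) :
  (forall i, 0 <= a 0 i) -> psdmx (diag_mx a).
Proof.
move=> a0; split=> [|x]; first by rewrite tr_diag_mx.
rewrite mul_mx_diag mxE sumr_ge0// => i _; rewrite !mxE mulrAC -expr2.
by rewrite mulr_ge0// sqr_ge0.
Qed.

Lemma psdmx_diag_conj m n (Q : 'M[R]_(m, n)) (a : 'rV[R]_m) :
  (forall i, 0 <= a 0 i) -> psdmx (Q^T *m diag_mx a *m Q).
Proof. by move=> /psdmx_diag/(psdmx_conj Q^T); rewrite trmxK. Qed.

Lemma psdmxD n (M M' : 'M[R]_n) : psdmx M -> psdmx M' -> psdmx (M + M').
Proof.
move=> [Ms M0] [M's M'0]; split=> [|x]; first by rewrite linearD/= Ms M's.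
by rewrite mulmxDr mulmxDl mxE addr_ge0.
Qed.

Lemma psdmx1 n : psdmx (1%:M : 'M[R]_n).
Proof. by rewrite -diag_const_mx; apply: psdmx_diag => i; rewrite mxE. Qed.

Lemma psdmx_gram m n (X : 'M[R]_(m, n)) : psdmx (X *m X^T).
Proof. by rewrite -[X in X *m _]mulmx1; exact/psdmx_conj/psdmx1. Qed.

Lemma pdmx_psdmx n (M : 'M[R]_n) : pdmx M -> psdmx M.
Proof.
case=> Msym M0; split=> // x; have [->|/M0/ltW//] := eqVneq x 0.
by rewrite mulmx0 mxE.
Qed.

Lemma psdmx_trace_ge0 n (M : 'M[R]_n) : psdmx M -> 0 <= \tr M.
Proof. by move=> M0; apply: sumr_ge0 => i _; exact: psdmx_diag_ge0. Qed.

Lemma psdmx_spectral n (M : 'M[R]_n) : psdmx M ->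
  exists (Q : 'M[R]_n) (a : 'rV[R]_n),
    [/\ Q^T *m Q = 1%:M, forall i, 0 <= a 0 i & M = Q^T *m diag_mx a *m Q].
Proof.
move=> Mpsd; have [Q [a [QQ ME]]] := symmetric_spectral Mpsd.1.
exists Q, a; split => // [|i]; first exact: mulmx1C.
(* The eigenvalues are the diagonal entries of [Q *m M *m Q^T], which is again semidefinite. *)
have /psdmx_diag_ge0 := psdmx_conj Q Mpsd => /(_ i).
by rewrite ME !mulmxA QQ mul1mx -mulmxA QQ mulmx1 mxE eqxx.
Qed.

(** Taking square roots of the eigenvalues exhibits a root, so [xget] does not return its
    default. *)
Lemma sqrtmxP n (M : 'M[R]_n) : psdmx M ->
  psdmx (sqrtmx M) /\ sqrtmx M *m sqrtmx M = M.
Proof.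
case/psdmx_spectral => Q [a [/mulmx1C QQ a0 ->]].
apply: (@xgetPex _ _ [set P | psdmx P /\ P *m P = Q^T *m diag_mx a *m Q]).
pose b : 'rV[R]_n := \row_i Num.sqrt (a 0 i).
exists (Q^T *m diag_mx b *m Q); split.
  apply: psdmx_diag_conj => i.
  by rewrite mxE sqrtr_ge0.
rewrite !mulmxA -[_ *m Q *m Q^T]mulmxA QQ mulmx1.
rewrite -[_ *m diag_mx b *m diag_mx b]mulmxA mulmx_diag.
congr (_ *m diag_mx _ *m _); apply/rowP => i.
by rewrite !mxE -expr2 sqr_sqrtr.
Qed.

(** In an eigenbasis of [P], row i of [X] has norm [a 0 i] and row i of [U] has norm at most 1.
    Cauchy-Schwarz, applied row by row, bounds the trace by the sum of the eigenvalues. *)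
Lemma contraction_trace_le m n (P : 'M[R]_m) (X U : 'M[R]_(m, n)) :
  psdmx P -> P *m P = X *m X^T -> psdmx (1%:M - U *m U^T) ->
  \tr (X *m U^T) <= \tr P.
Proof.
case/psdmx_spectral => Q [a [QtQ a0 PE]] PP U1; have QQ := mulmx1C QtQ.
have trE (M : 'M[R]_m) : \tr M = \tr (Q *m M *m Q^T).
  by rewrite mxtrace_mulC mulmxA QtQ mul1mx.
pose Y := Q *m X; pose V := Q *m U.
have YY i : (Y *m Y^T) i i = a 0 i ^+ 2.
  rewrite /Y trmx_mul mulmxA -[_ *m X *m _]mulmxA -PP PE !mulmxA QQ mul1mx.
  rewrite -[_ *m Q *m Q^T]mulmxA QQ mulmx1 -[_ *m Q *m Q^T]mulmxA QQ mulmx1.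
  by rewrite mulmx_diag !mxE eqxx.
have VV i : (V *m V^T) i i <= 1.
  have /psdmx_diag_ge0 := psdmx_conj Q U1 => /(_ i).
  rewrite mulmxBr mulmx1 mulmxBl QQ /V trmx_mul !mulmxA.
  by rewrite mxE [X in X + _]mxE eqxx mxE subr_ge0.
rewrite [leLHS]trE !mulmxA -[_ *m U^T *m _]mulmxA -trmx_mul -/Y -/V.
rewrite [leRHS]trE PE !mulmxA QQ mul1mx -mulmxA QQ mulmx1 mxtrace_diag.
clearbody Y V; apply: ler_sum => i _; rewrite mxE.
have Yi : \sum_j Y i j ^+ 2 = a 0 i ^+ 2.
  by rewrite -YY mxE; apply: eq_bigr => j _; rewrite mxE expr2.
have Vi : \sum_j V i j ^+ 2 <= 1.
  by apply: le_trans (VV i); rewrite mxE ler_sum// => j _; rewrite mxE expr2.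
under eq_bigr do rewrite mxE.
(* A zero eigenvalue forces the row of [Y] to vanish; otherwise [a 0 i] can be cancelled at the
   end. *)
have [ai0|aiN0] := eqVneq (a 0 i) 0.
  move: Yi; rewrite ai0 expr0n/= => Yi0; rewrite big1// => j _.
  have /(_ j isT)/eqP := psumr_eq0P (fun j _ => sqr_ge0 (Y i j)) Yi0.
  by rewrite sqrf_eq0 => /eqP ->; rewrite mul0r.
have ai : 0 < a 0 i by rewrite lt_def aiN0 a0.
(* With a = [a 0 i], expanding gives 0 <= a^2 - 2ap + a^2 q with q <= 1, hence ap <= a^2. *)
have : 0 <= \sum_j (Y i j - a 0 i * V i j) ^+ 2.
  by apply: sumr_ge0 => j _; exact: sqr_ge0.
have -> : \sum_j (Y i j - a 0 i * V i j) ^+ 2 = \sum_j Y i j ^+ 2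
  - 2 * a 0 i * (\sum_j Y i j * V i j) + a 0 i ^+ 2 * (\sum_j V i j ^+ 2).
  rewrite !mulr_sumr -sumrB -big_split/=; apply: eq_bigr => j _; ring.
rewrite Yi; set p := \sum_j Y i j * _; set q := \sum_j _ in Vi *.
move=> h; rewrite -(ler_pM2l ai); nra.
Qed.

(** The maximizer is the partial isometry of the polar decomposition of [X], obtained by applying
    the pseudo-inverse of [P] to [X]. *)
Lemma contraction_trace_eq m n (P : 'M[R]_m) (X : 'M[R]_(m, n)) :
  psdmx P -> P *m P = X *m X^T ->
  exists U : 'M[R]_(m, n), psdmx (1%:M - U *m U^T) /\ \tr (X *m U^T) = \tr P.
Proof.
case/psdmx_spectral => Q [a [QtQ a0 PE]] PP; have QQ := mulmx1C QtQ.
(* The Moore-Penrose inverse of P, thanks to 0^-1 = 0. *)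
pose E := Q^T *m diag_mx (map_mx (@GRing.inv R) a) *m Q.
have Esym : E^T = E by rewrite /E !trmx_mul trmxK tr_diag_mx mulmxA.
pose b : 'rV[R]_m := \row_i (a 0 i == 0)%:R.
have conjM (c e : 'rV[R]_m) : (Q^T *m diag_mx c *m Q) *m (Q^T *m diag_mx e *m Q)
    = Q^T *m diag_mx (\row_i (c 0 i * e 0 i)) *m Q.
  rewrite !mulmxA -[_ *m Q *m Q^T]mulmxA QQ mulmx1.
  by rewrite -[_ *m diag_mx c *m _]mulmxA mulmx_diag.
exists (E *m X); rewrite trmx_mul Esym; split; last first.
  rewrite mulmxA -PP PE /E !conjM; congr (\tr (_ *m diag_mx _ *m _)).
  apply/rowP => i; rewrite !mxE; have [->|ai] := eqVneq (a 0 i) 0.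
    by rewrite !mul0r.
  by rewrite mulfK.
(* [U *m U^T] is the orthogonal projection onto the range of [P]; its complement, with spectrum [b],
   projects onto the kernel. *)
suff -> : 1%:M - E *m X *m (X^T *m E) = Q^T *m diag_mx b *m Q.
  apply: psdmx_diag_conj => i.
  by rewrite mxE ler0n.
rewrite mulmxA -[E *m X *m _]mulmxA -PP PE /E !conjM -[1%:M]QtQ.
rewrite -[X in X *m Q - _]mulmx1 -mulmxBl -mulmxBr -diag_const_mx -linearB/=.
congr (_ *m diag_mx _ *m _); apply/rowP => i; rewrite !mxE.
have [->|ai] := eqVneq (a 0 i) 0; first by rewrite !mulr0 mul0r subr0.
by rewrite mulKf// divff// subrr.
Qed.

(** An optimal contraction for [X + Y] is admissible for [X] and for [Y]. Arbitrary semidefinite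
    roots are allowed so that scaled roots [c *: sqrtmx _] can be supplied directly. *)
Lemma trace_sqrt_gram_triangle m n (P P1 P2 : 'M[R]_m) (X Y : 'M[R]_(m, n)) :
  psdmx P -> P *m P = (X + Y) *m (X + Y)^T ->
  psdmx P1 -> P1 *m P1 = X *m X^T -> psdmx P2 -> P2 *m P2 = Y *m Y^T ->
  \tr P <= \tr P1 + \tr P2.
Proof.
move=> P0 PP P10 PP1 P20 PP2.
have [U [U1 <-]] := contraction_trace_eq P0 PP.
by rewrite mulmxDl mxtraceD lerD// contraction_trace_le.
Qed.

End Semidefinite.

(** * Convexity of the trace functionals, and the second moment of white noise *)

Section Convexity.
Variable R : realType.

(** With q(Z) = tr(Z S Z^T), the right side minus the left side is t(1 - t) q(X - Y). *)
Lemma trace_quadratic_convex m n (S : 'M[R]_n) (X Y : 'M[R]_(m, n)) (t : R) :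
  psdmx S -> 0 <= t <= 1 ->
  \tr ((t *: X + (1 - t) *: Y) *m S *m (t *: X + (1 - t) *: Y)^T)
    <= t * \tr (X *m S *m X^T) + (1 - t) * \tr (Y *m S *m Y^T).
Proof.
move=> S0 /andP[t0 t1]; pose b (Z W : 'M[R]_(m, n)) := \tr (Z *m S *m W^T).
have bE c e : \tr ((c *: X + e *: Y) *m S *m (c *: X + e *: Y)^T) =
    c ^+ 2 * b X X + c * e * (b X Y + b Y X) + e ^+ 2 * b Y Y.
  have -> : (c *: X + e *: Y)^T = c *: X^T + e *: Y^T.
    by rewrite linearD/= !linearZ.
  rewrite mulmxDl -!scalemxAl mulmxDl -!scalemxAl !mulmxDr -!scalemxAr.
  rewrite !(mxtraceD, mxtraceZ) -/(b X X) -/(b X Y) -/(b Y X) -/(b Y Y); ring.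
(* This is q(X - Y) >= 0, written with coefficients 1 and -1 so that [bE] expands it. *)
have := psdmx_trace_ge0 (psdmx_conj (1 *: X + (-1) *: Y) S0).
rewrite !bE -/(b X X) -/(b Y Y) => XY0.
have ts0 : 0 <= t * (1 - t) by rewrite mulr_ge0// subr_ge0.
rewrite -subr_ge0; apply: le_trans (mulr_ge0 ts0 XY0) _.
by rewrite le_eqVlt; apply/orP; left; apply/eqP; ring.
Qed.

Lemma trace_sqrt_convex m n (S : 'M[R]_n) (X Y : 'M[R]_(m, n)) (s t : R) :
  psdmx S -> 0 <= s -> 0 <= t ->
  \tr (sqrtmx ((s *: X + t *: Y) *m S *m (s *: X + t *: Y)^T))
    <= s * \tr (sqrtmx (X *m S *m X^T)) + t * \tr (sqrtmx (Y *m S *m Y^T)).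
Proof.
move=> S0 s0 t0.
have [[Lsym _] LL] := sqrtmxP S0; set L := sqrtmx S in Lsym LL.
have gramE (Z : 'M[R]_(m, n)) : Z *m S *m Z^T = (Z *m L) *m (Z *m L)^T.
  by rewrite trmx_mul Lsym -LL !mulmxA.
have sqrtP (Z : 'M[R]_(m, n)) := sqrtmxP (psdmx_conj Z S0).
(* Positive homogeneity: a scaled root is a semidefinite root of the Gram matrix of the scaled
   factor. *)
have sqrtZ (c : R) (Z : 'M[R]_(m, n)) (P := c *: sqrtmx (Z *m S *m Z^T)) :
    0 <= c -> psdmx P /\ P *m P = (c *: (Z *m L)) *m (c *: (Z *m L))^T.
  move=> c0; have [[Psym P0] PP] := sqrtP Z; split; last first.
    rewrite [in RHS]linearZ/= /P -!scalemxAl -!scalemxAr PP gramE.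
    by rewrite !scalerA.
  split=> [|x]; first by rewrite /P linearZ/= Psym.
  by rewrite /P -scalemxAr -scalemxAl mxE mulr_ge0.
have [Ppsd PP] := sqrtP (s *: X + t *: Y).
have [P1psd PP1] := sqrtZ s X s0; have [P2psd PP2] := sqrtZ t Y t0.
rewrite -!mxtraceZ; apply:
  (trace_sqrt_gram_triangle Ppsd _ P1psd PP1 P2psd PP2).
by rewrite PP gramE mulmxDl !scalemxAl.
Qed.

(** The 1 x 1 identity is inserted so that [trace_quadratic_convex] covers the squared norms in
    [J1]. *)
Lemma norm2_sqr n (x : 'cV[R]_n) : norm2 x ^+ 2 = \tr (x *m 1%:M *m x^T).
Proof.
rewrite mulmx1 sqr_sqrtr ?sumr_ge0// => [|i _]; last exact: sqr_ge0.
by apply: eq_bigr => i _; rewrite mxE big_ord1 mxE expr2.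
Qed.

Lemma white_noise_second_moment (d : measure_display) (T : measurableType d)
    (P : probability T R) (N n : nat) (w : 'I_N -> T -> 'cV[R]_n) :
  white_gaussian_noise P w ->
  expectation_mx P (fun t => stack w t *m (stack w t)^T) = 1%:M.
Proof.
case=> _ _ ww; apply/mxblockP => i j.
transitivity (expectation_mx P (fun t => w i t *m (w j t)^T)).
  apply/matrixP => a b; rewrite !mxE; congr (fine _); congr expectation.
  apply/funext => t; rewrite !mxE; apply: eq_bigr => k _; rewrite !mxE.
  (* [tagnat.Rank l c] is the position in the stack of entry c of block l. *)
  have stackE l c : stack w t (tagnat.Rank l c) 0 = w l t c 0.
    by rewrite -[in RHS](mxcolK (fun l => w l t) l) [RHS]mxE.
  by move: (stackE i a) (stackE j b); rewrite !mxE (ord1 k) => -> ->.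
rewrite ww; apply/matrixP => a b; rewrite !mxE.
rewrite -[tagnat.Rank i a == _]val_eqE tagnat.eq_Rank.
by case: (i == j); rewrite //= mul0rn.
Qed.
End Convexity.

(** * Convexity of the four cost terms and the resulting decomposition *)

Theorem proposition1
  (R : realType) (nx nu nw N : nat)
  (nx_gt0 : (0 < nx)%N) (nu_gt0 : (0 < nu)%N)
  (nw_gt0 : (0 < nw)%N) (N_gt0 : (0 < N)%N)
  (mu0 mud : 'cV[R]_nx) (S0 Sd : 'M[R]_nx)
  (S0_pd : pdmx S0) (Sd_pd : pdmx Sd)
  (A : 'I_N.+1 -> 'M[R]_nx) (B : 'I_N.+1 -> 'M[R]_(nx, nu))
  (G : 'I_N.+1 -> 'M[R]_(nx, nw))
  (lambda : R) (lambda_gt0 : 0 < lambda)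
  (d : measure_display) (Omega : measurableType d) (P : probability Omega R)
  (w : 'I_N -> Omega -> 'cV[R]_nw) (w_white : white_gaussian_noise P w) :
  let Gam := Gamma A in
  let Hu := Hmx A B in
  let Hw := Hmx A G in
  let F := Fmx R N nx in
  let Sw := expectation_mx P (fun t => stack w t *m (stack w t)^T) in
  let St := Gam *m S0 *m Gam^T + Hw *m Sw *m Hw^T in
  let T := @block_lower_triangular R N nx nu in
  let J1 := fun uff : 'cV[R]_(\sum_(j < N) nu) =>
    norm2 uff ^+ 2
    + lambda * norm2 (F *m (Gam *m mu0 + Hu *m uff) - mud) ^+ 2 in
  let J2 := fun Theta : 'M[R]_(\sum_(i < N) nu, \sum_(j < N.+1) nx) =>
    \tr (Theta *m St *m Theta^T) in
  let J3 := fun Theta : 'M[R]_(\sum_(i < N) nu, \sum_(j < N.+1) nx) =>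
    lambda * \tr (F *m (1%:M + Hu *m Theta) *m St
                    *m (1%:M + Hu *m Theta)^T *m F^T) + \tr Sd in
  let J4 := fun Theta : 'M[R]_(\sum_(i < N) nu, \sum_(j < N.+1) nx) =>
    2 * lambda * \tr (sqrtmx (sqrtmx Sd *m F *m (1%:M + Hu *m Theta) *m St
                    *m (1%:M + Hu *m Theta)^T *m F^T *m sqrtmx Sd)) in
  [/\ convex_function setT J1,
      convex_function T J2,
      convex_function T J3,
      convex_function T J4
    & is_dcp (Minimization (setT `*` T)
        (fun z : 'cV[R]_(\sum_(j < N) nu)
                 * 'M[R]_(\sum_(i < N) nu, \sum_(j < N.+1) nx) =>
           J1 z.1 + J2 z.2 + J3 z.2 - J4 z.2))].
Proof.
move=> Gam Hu Hw F Sw St T J1 J2 J3 J4.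
have S0psd := pdmx_psdmx S0_pd.
have Stpsd : psdmx St.
  apply: psdmxD; first exact: psdmx_conj.
  by apply: psdmx_conj; rewrite /Sw (white_noise_second_moment w_white);
    exact: psdmx1.
have conv_itv (t : {i01 R}) : 0 <= t%:num <= 1 by rewrite ge0 le1.
have convE (t : {i01 R}) (a b : R^o) :
    a <| t |> b = t%:num * a + (1 - t%:num) * b.
  by [].
have affineE p q (C : 'M[R]_(p, q)) (c : R) : c *: C + (1 - c) *: C = C.
  by rewrite -scalerDl addrC subrK scale1r.
(* The affine map shared by [J3] and [J4]. Its constant term survives convex combinations because
   the weights sum to 1. *)
pose Mx (Theta : 'M[R]_(\sum_(i < N) nu, \sum_(j < N.+1) nx)) :=
  F *m (1%:M + Hu *m Theta).
have MxE c X Y : Mx (c *: X + (1 - c) *: Y) = c *: Mx X + (1 - c) *: Mx Y.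
  rewrite /Mx !scalemxAr -mulmxDr; congr (_ *m _).
  rewrite !scalerDr addrACA affineE mulmxDr -!scalemxAr; reflexivity.
have J1c : convex_function setT J1.
  move=> t x y _ _; rewrite /J1 !norm2_sqr convE.
  have -> : F *m (Gam *m mu0 + Hu *m (x <| t |> y)) - mud
    = t%:num *: (F *m (Gam *m mu0 + Hu *m x) - mud)
      + (1 - t%:num) *: (F *m (Gam *m mu0 + Hu *m y) - mud).
    rewrite !scalerBr addrACA -opprD affineE; congr (_ - _).
    rewrite !scalemxAr -mulmxDr; congr (_ *m _).
    by rewrite !scalerDr addrACA affineE !scalemxAr -mulmxDr.
  rewrite !mulrDr addrACA.
  have h1 := trace_quadratic_convex x y (psdmx1 _ _) (conv_itv t).
  have h2 := trace_quadratic_convex (F *m (Gam *m mu0 + Hu *m x) - mud)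
    (F *m (Gam *m mu0 + Hu *m y) - mud) (psdmx1 _ _) (conv_itv t).
  by apply: lerD => //; rewrite !(mulrCA _ lambda) -mulrDr ler_pM2l.
have J2c : convex_function T J2.
  by move=> t x y _ _; exact: trace_quadratic_convex.
have J3c : convex_function T J3.
  move=> t x y _ _; rewrite convE.
  have J3E Theta :
      J3 Theta = lambda * \tr (Mx Theta *m St *m (Mx Theta)^T) + \tr Sd.
    by rewrite /J3 /Mx trmx_mul !mulmxA.
  rewrite !J3E MxE.
  have := trace_quadratic_convex (Mx x) (Mx y) Stpsd (conv_itv t).
  rewrite -(ler_pM2l lambda_gt0); lra.
have J4c : convex_function T J4.
  move=> t x y _ _; rewrite convE.
  have [[Sdsym _] _] := sqrtmxP (pdmx_psdmx Sd_pd).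
  (* Symmetry of [sqrtmx Sd] lets the outer factors be absorbed into the form X S X^T. *)
  have J4E Theta : J4 Theta = 2 * lambda * \tr (sqrtmx
      ((sqrtmx Sd *m Mx Theta) *m St *m (sqrtmx Sd *m Mx Theta)^T)).
    by rewrite /J4 /Mx !trmx_mul Sdsym !mulmxA.
  rewrite !J4E MxE (mulmxDr (sqrtmx Sd)) -!(scalemxAr _ (sqrtmx Sd)).
  have /andP[t0 t1] := conv_itv t.
  have t1' : 0 <= 1 - t%:num by rewrite subr_ge0.
  have := trace_sqrt_convex (sqrtmx Sd *m Mx x) (sqrtmx Sd *m Mx y)
    Stpsd t0 t1'.
  rewrite -(ler_pM2l lambda_gt0); lra.
split => //; split.
  move=> x y t; rewrite !inE => -[_ Tx] [_ Ty]; split => // i j ij.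
  (* A convex combination of pairs is taken componentwise; here its matrix component is exposed. *)
  change (submxblock (t%:num *: x.2 + (1 - t%:num) *: y.2) i j = 0).
  apply/matrixP => a b; have /matrixP/(_ a b) := Tx i j ij.
  have /matrixP/(_ a b) := Ty i j ij.
  by rewrite !mxE => -> ->; rewrite !mulr0 addr0.
(* Each term depends on one component of the pair, so the separate convexity results transfer to the
   product. *)
exists (fun z => J1 z.1 + J2 z.2 + J3 z.2), (fun z => J4 z.2); split => //.
  move=> t x y; rewrite !inE => -[_ Tx] [_ Ty]; rewrite convE.
  have h1 := J1c t x.1 y.1 (in_setT _) (in_setT _).
  have h2 := J2c t x.2 y.2 (mem_set Tx) (mem_set Ty).
  have h3 := J3c t x.2 y.2 (mem_set Tx) (mem_set Ty).
  apply: le_trans (lerD (lerD h1 h2) h3) _; rewrite !convE.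
  rewrite !mulrDr; lra.
move=> t x y; rewrite !inE => -[_ Tx] [_ Ty].
exact: J4c t x.2 y.2 (mem_set Tx) (mem_set Ty).
Qed.
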